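(* Let $\varphi:\mathbb{R}\to\mathbb{R}$, $\varphi(t)=\max\{0,t\}$ (the ReLU function, which is slope-restricted with $\alpha=0$, $\beta=1$), let $\phi:\mathbb{R}^2\to\mathbb{R}^2$ apply $\varphi$ to each coordinate, and let $T=(e_1-e_2)(e_1-e_2)^\top\in\mathcal{T}_2$. Then for $\tilde x=\begin{bmatrix}0&1\end{bmatrix}^\top$ and $\tilde y=\begin{bmatrix}-1.5&0\end{bmatrix}^\top$, $$\begin{bmatrix}\tilde x-\tilde y\\ \phi(\tilde x)-\phi(\tilde y)\end{bmatrix}^\top\begin{bmatrix}0&T\\ T&-2T\end{bmatrix}\begin{bmatrix}\tilde x-\tilde y\\ \phi(\tilde x)-\phi(\tilde y)\end{bmatrix}<0 .$$ Consequently, it is false that for every function $\varphi$ slope-restricted with bounds $0\le\alpha<\beta<\infty$, every $n$, every $T\in\mathcal{T}_n$ and all $\tilde x,\tilde y\in\mathbb{R}^n$ (with $\phi$ acting coordinatewise by $\varphi$) one has $$\begin{bmatrix}\tilde x-\tilde y\\ \phi(\tilde x)-\phi(\tilde y)\end{bmatrix}^\top\begin{bmatrix}-2\alpha\beta T&(\alpha+\beta)T\\ (\alpha+\beta)T&-2T\end{bmatrix}\begin{bmatrix}\tilde x-\tilde y\\ \phi(\tilde x)-\phi(\tilde y)\end{bmatrix}\ge 0 .$$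
   Context: $e_i$ denotes the $i$-th standard basis vector. A function $\varphi:\mathbb{R}\to\mathbb{R}$ is slope-restricted with bounds $\alpha,\beta$ if $\alpha\le\frac{\varphi(x)-\varphi(y)}{x-y}\le\beta$ for all real $x\neq y$. The set of symmetric coupling matrices is $$\mathcal{T}_n=\Big\{T\in\mathbb{R}^{n\times n}\ \Big|\ T=\sum_{i=1}^n\lambda_{ii}e_ie_i^\top+\sum_{1\le i<j\le n}\lambda_{ij}(e_i-e_j)(e_i-e_j)^\top,\ \lambda_{ij}\ge 0\Big\}.$$ *)

(* Defs.v *)
From mathcomp Require Import all_boot all_order all_algebra.
From mathcomp Require Import reals.

Set Implicit Arguments.
Unset Strict Implicit.
Unset Printing Implicit Defensive.

Import Order.TTheory GRing.Theory Num.Theory.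
Local Open Scope ring_scope.

Definition slope_restricted (R : realType) (alpha beta : R) (phi : R -> R) : Prop :=
  forall x y : R, x <> y ->
    alpha <= (phi x - phi y) / (x - y) /\ (phi x - phi y) / (x - y) <= beta.

Definition relu (R : realType) (t : R) : R := Num.max 0 t.

(* Indices are 0-based: e_1, ..., e_n are
   std_basis 0, ..., std_basis (n-1). *)
Definition std_basis (R : realType) (n : nat) (i : 'I_n) : 'cV[R]_n :=
  delta_mx i 0.

(* Only the entries lambda i j with i <= j are used, hence constrained. *)
Definition coupling_matrix (R : realType) (n : nat) (T : 'M[R]_n) : Prop :=
  exists lambda : 'I_n -> 'I_n -> R,
    (forall i j : 'I_n, (i <= j)%N -> 0 <= lambda i j) /\
    T = \sum_(i < n) lambda i i *: (std_basis R i *m (std_basis R i)^T)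
      + \sum_(i < n) \sum_(j < n | (i < j)%N)
          lambda i j *: ((std_basis R i - std_basis R j)
                           *m (std_basis R i - std_basis R j)^T).

Definition quad_form (R : realType) (m : nat) (M : 'M[R]_m) (z : 'cV[R]_m) : R :=
  (z^T *m M *m z) 0 0.

Definition increment_vec (R : realType) (n : nat) (phi : R -> R)
    (x y : 'cV[R]_n) : 'cV[R]_(n + n) :=
  col_mx (x - y) (map_mx phi x - map_mx phi y).

(* Main.v *)
(* For the rank-one matrix T = v v^T the quadratic form at (d, f) equals
   2 (v^T d) (v^T f) - 2 (v^T f)^2.  With v = e_1 - e_2 the two increments
   v^T d = 1/2 and v^T f = -1 have opposite signs, because the difference of two
   coordinates need not keep its sign under a monotone map applied
   coordinatewise; the form is then -3. *)
Require Import Defs.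
From mathcomp Require Import all_boot all_order all_algebra.
From mathcomp Require Import reals.
From mathcomp Require Import lra ring.

Set Implicit Arguments.
Unset Strict Implicit.
Unset Printing Implicit Defensive.

Import Order.TTheory GRing.Theory Num.Theory.
Local Open Scope ring_scope.

(** The quotient is symmetric in [x] and [y], so the case [y < x] suffices; clearing the positive
    denominator leaves inequalities that are linear once the signs of [x] and [y] are fixed. *)
Lemma relu_slope_restricted (R : realType) : slope_restricted 0 1 (@relu R).
Proof.
have slope_lt (x y : R) : y < x ->
    0 <= (relu x - relu y) / (x - y) /\ (relu x - relu y) / (x - y) <= 1.
  move=> yx; have xy_gt0 : 0 < x - y by rewrite subr_gt0.
  rewrite ler_pdivrMr // mul1r pmulr_lge0 ?invr_gt0 //.
  by rewrite /relu; case: (leP 0 x); case: (leP 0 y) => *; split; lra.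
move=> x y /eqP; rewrite neq_lt => /orP[xy|]; last exact: slope_lt.
by rewrite -(opprB y x) -(opprB (relu y)) invrN mulrNN; apply: slope_lt.
Qed.

Lemma coupling_matrix_diff (R : realType) (n : nat) (i j : 'I_n) :
  (i < j)%N ->
  coupling_matrix ((std_basis R i - std_basis R j)
                     *m (std_basis R i - std_basis R j)^T).
Proof.
(* The weights are the indicator of the pair [(i, j)]; as [i < j], every diagonal weight is 0. *)
move=> lt_ij; exists (fun k l => ((k == i) && (l == j))%:R); split=> [k l _|].
  exact: ler0n.
rewrite big1 ?add0r => [|k _]; last first.
  have -> : (k == i) && (k == j) = false.
    by apply/negP => /andP[/eqP-> /eqP eq_ij]; rewrite eq_ij ltnn in lt_ij.
  by rewrite scale0r.
rewrite (bigD1 i) //= (bigD1 j) //= !eqxx scale1r.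
rewrite big1 ?addr0 => [|l /andP[_ /negPf->]]; last by rewrite scale0r.
rewrite big1 ?addr0 // => k /negPf->.
by rewrite big1 // => l _; rewrite scale0r.
Qed.

(** A block [k *: (v *m v^T)] between [u^T] and [w] factors through two scalars, so the form sees
    [d] and [f] only through [p] and [q]. *)
Lemma quad_form_block_outer (R : realType) (n : nat) (a b c e : R)
    (v d f : 'cV[R]_n) :
  let T := v *m v^T in
  let p := (v^T *m d) 0 0 in
  let q := (v^T *m f) 0 0 in
  quad_form (block_mx (a *: T) (b *: T) (c *: T) (e *: T)) (col_mx d f) =
    a * p ^+ 2 + (b + c) * (p * q) + e * q ^+ 2.
Proof.
move=> T p q.
have outerE (k : R) (u w : 'cV[R]_n) :
    (u^T *m (k *: T) *m w) 0 0 = k * ((v^T *m u) 0 0 * (v^T *m w) 0 0).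
  rewrite -scalemxAr -scalemxAl /T mulmxA -(mulmxA (u^T *m v)) [LHS]mxE.
  congr (_ * _); rewrite [LHS]mxE big_ord1; congr (_ * _).
  (* A 1 by 1 matrix equals its transpose, which turns [u^T *m v] into [v^T *m u]. *)
  by rewrite -[u^T *m v]trmxK trmx_mul trmxK [LHS]mxE.
rewrite /quad_form tr_col_mx mul_row_block mul_row_col !mulmxDl.
rewrite [LHS]mxE [X in X + _]mxE [X in _ + X]mxE !outerE -/p -/q; ring.
Qed.

Lemma tr_basis_diff_mul (R : realType) (n : nat) (i j : 'I_n) (d : 'cV[R]_n) :
  ((std_basis R i - std_basis R j)^T *m d) 0 0 = d i 0 - d j 0.
Proof.
by rewrite /std_basis linearB /= !trmx_delta mulmxBl -!rowE !mxE.
Qed.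

Theorem mainTheorem3 (R : realType) :
  (let e1 : 'cV[R]_2 := std_basis R 0 in
   let e2 : 'cV[R]_2 := std_basis R 1 in
   let T : 'M[R]_2 := (e1 - e2) *m (e1 - e2)^T in
   let x : 'cV[R]_2 := \col_(i < 2) [:: 0; 1]`_i in
   let y : 'cV[R]_2 := \col_(i < 2) [:: - (3 / 2); 0]`_i in
   slope_restricted 0 1 (@relu R) /\
   coupling_matrix T /\
   quad_form (block_mx 0 T T (- 2 *: T)) (increment_vec (@relu R) x y) < 0) /\
  ~ (forall (phi : R -> R) (alpha beta : R),
       0 <= alpha -> alpha < beta -> slope_restricted alpha beta phi ->
       forall (n : nat) (T : 'M[R]_n), coupling_matrix T ->
       forall x y : 'cV[R]_n,
         0 <= quad_form
                (block_mx (- 2 * alpha * beta *: T) ((alpha + beta) *: T)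
                          ((alpha + beta) *: T) (- 2 *: T))
                (increment_vec phi x y)).
Proof.
(* The first conjunct is named because the refutation of the general claim reuses it. *)
set P := (X in X /\ _).
have HP : P.
  split; first exact: relu_slope_restricted.
  split; first exact: coupling_matrix_diff.
  set T := _ *m _^T.
  have -> : block_mx 0 T T (- 2 *: T) =
            block_mx (0 *: T) (1 *: T) (1 *: T) (- 2 *: T).
    by rewrite scale0r !scale1r.
  (* Here [p = (0 + 3/2) - (1 - 0) = 1/2] and [q = (0 - 0) - (1 - 0) = -1]. *)
  rewrite quad_form_block_outer !tr_basis_diff_mul !mxE /= /relu.
  rewrite maxxx (max_r ler01) (max_l (_ : - (3 / 2) <= 0)); lra.
split=> [|form_ge0]; first exact: HP.
have [relu_slope [T_coupling]] := HP.
have := form_ge0 _ _ _ (lexx 0) ltr01 relu_slope _ _ T_coupling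
  (\col_(i < 2) [:: 0; 1]`_i) (\col_(i < 2) [:: - (3 / 2); 0]`_i).
(* At [alpha = 0], [beta = 1] the general block matrix reduces to the one in [P]. *)
by rewrite mulr0 mul0r scale0r add0r scale1r leNgt => /negP.
Qed.
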